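(* Let $\mathcal{S}$ be a (finite) regular near $2d$-gon of order $(s,t_2,t_3,\ldots,t_{d-1},t)$, with the conventions $t_0=-1$, $t_1=0$, $t_d=t$, such that for some integer $i$ with $3\le i\le d$, \[ t_i+1=\frac{(s^i+(-1)^i)\,(t_{i-1}+1+(-1)^i s^{i-2})}{s^{i-2}+(-1)^i}. \] If a nontrivial $m$-ovoid of $\mathcal{S}$ exists, then it is a hemisystem, i.e. $m=(s+1)/2$.
   Context: The collinearity graph of a point-line geometry has the points as vertices, two distinct points being adjacent when they lie on a common line; distances between points are measured in this graph. A near $2d$-gon ($d\ge 2$) is a point-line incidence geometry in which every two points lie on at most one line, whose collinearity graph is connected of diameter $d$, and such that for every point $P$ and every line $\ell$ there is a unique point on $\ell$ nearest to $P$. It has order $(s,t)$ if every line is incident with exactly $s+1$ points and every point is incident with exactly $t+1$ lines (with $s,t$ finite). A near $2d$-gon of order $(s,t)$ is regular, with parameters (or order) $(s,t_2,t_3,\ldots,t_{d-1},t)$, if there are constants $t_0,t_1,\ldots,t_d$ such that whenever two points $x$ and $y$ are at distance $i$, there are exactly $t_i+1$ lines on $y$ containing a point at distance $i-1$ from $x$; here $t_0=-1$, $t_1=0$ and $t_d=t$. An $m$-ovoid of $\mathcal{S}$ is a set $\mathcal{O}$ of points such that every line is incident with exactly $m$ points of $\mathcal{O}$. The trivial $m$-ovoids are the empty set ($m=0$) and the set of all points ($m=s+1$); all others are nontrivial. A hemisystem is an $m$-ovoid for which $m$ is exactly half of the number of points on a line, i.e. $m=(s+1)/2$. *)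

(* Defs.v *)
From mathcomp Require Import all_boot all_order all_algebra.

Set Implicit Arguments.
Unset Strict Implicit.
Unset Printing Implicit Defensive.

Import GRing.Theory Num.Theory.

Section Graph.

Variables (T : finType) (e : rel T).

Definition has_walk (n : nat) (x y : T) : bool :=
  [exists p : n.-tuple T, path e x p && (last x p == y)].

(* Length of a shortest walk from x to y. A shortest walk has fewer than #|T|
   steps, so the value #|T| is taken exactly when y is not reachable from x. *)
Definition gdist (x y : T) : nat :=
  find (fun n => has_walk n x y) (iota 0 #|T|).

Definition gconnected : Prop := forall x y : T, connect e x y.

Definition diameter : nat := \max_(x : T) \max_(y : T) gdist x y.

End Graph.

Section Geometry.

Variables (P L : finType) (inc : P -> L -> bool).

Definition points_on (l : L) : {set P} := [set x | inc x l].

Definition lines_on (x : P) : {set L} := [set l | inc x l].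

Definition collinear : rel P :=
  [rel x y | (x != y) && [exists l, inc x l && inc y l]].

Definition pdist : P -> P -> nat := gdist collinear.

Definition partial_linear : Prop :=
  forall (x y : P) (l l' : L), x <> y ->
    inc x l -> inc y l -> inc x l' -> inc y l' -> l = l'.

Definition nearest_on (x : P) (l : L) (y : P) : Prop :=
  inc y l /\ forall z : P, inc z l -> pdist x y <= pdist x z.

Definition near_polygon (d : nat) : Prop :=
  [/\ 2 <= d,
      partial_linear,
      gconnected collinear,
      diameter collinear = d
    & forall (x : P) (l : L), exists! y : P, nearest_on x l y].

Definition has_order (s t : nat) : Prop :=
  (forall l : L, #|points_on l| = s.+1) /\
  (forall x : P, #|lines_on x| = t.+1).

(* "Distance i - 1" is written as (pdist x z).+1 == i, so that for i = 0 no
   point z qualifies, in accordance with t_0 = -1. *)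
Definition lines_toward (x y : P) (i : nat) : {set L} :=
  [set l in lines_on y | [exists z, inc z l && ((pdist x z).+1 == i)]].

(* Only the values ti 0, ..., ti d matter. *)
Definition regular_near_polygon (d s t : nat) (ti : nat -> int) : Prop :=
  [/\ near_polygon d,
      has_order s t,
      [/\ ti 0%N = -1, ti 1%N = 0 & ti d = t%:Z]%R
    & forall (i : nat) (x y : P), pdist x y = i ->
        (#|lines_toward x y i|%:Z = ti i + 1)%R].

Definition m_ovoid (m : nat) (O : {set P}) : Prop :=
  forall l : L, #|O :&: points_on l| = m.

Definition nontrivial_m_ovoid (m : nat) (O : {set P}) : Prop :=
  [/\ m_ovoid m O, O <> set0 & O <> [set: P]].

(* The halving takes place in rat; in particular s is odd. *)
Definition hemisystem (s m : nat) (O : {set P}) : Prop :=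
  m_ovoid m O /\ (m%:R = (s%:R + 1) / 2 :> rat)%R.

End Geometry.

(* Main.v *)
Require Import Defs.
From mathcomp Require Import all_boot all_order all_algebra.
From mathcomp Require Import zify ring lra.

Set Implicit Arguments.
Unset Strict Implicit.
Unset Printing Implicit Defensive.

Import Order.TTheory GRing.Theory Num.Theory.

(* Let V be the space of functions on points summing to 0 on every line, and
   q = -1/s. The functions E_x(z) = q^d(x,z) lie in V, and <E_x, f> = C f(x) for
   every f in V, with C > 0 constant. For x, y at distance i let S(x,y) be the set
   of neighbours of x at distance i - 1 from y. The hypothesis on t_i says that the
   Gram matrix of E_x + E_y and the sum of the E_u over S(x,y) and S(y,x) is
   singular; the resulting linear dependency gives, for all f in V,
     f(S(x,y)) + f(S(y,x)) = kappa (f(x) + f(y)).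
   Multiplying by f(x) f(y) and summing over all pairs (x,y) at distance i yields
   (t_i + 1 - kappa) sum f^3 = 0 up to a nonzero factor, so sum f^3 = 0. For
   f = 1_O - mu with mu = m/(s+1) one has f^2 = (1 - 2 mu) f + mu (1 - mu), hence
   (1 - 2 mu) sum f^2 = 0 and mu = 1/2. *)

(** * Distance in a connected symmetric graph *)

Section GraphDistance.

Variables (T : finType) (e : rel T).
Hypotheses (e_sym : symmetric e) (e_conn : gconnected e).

Lemma has_walkP (n : nat) (x y : T) :
  reflect (exists p, [/\ size p = n, path e x p & last x p = y])
          (has_walk e n x y).
Proof.
apply: (iffP existsP) => [[p /andP[ep /eqP <-]]|[p [sp ep <-]]].
  by exists p; rewrite size_tuple.
have sp' : size p == n by rewrite sp.
by exists (Tuple sp'); rewrite /= ep eqxx.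
Qed.

Lemma gdist_le (n : nat) (x y : T) : has_walk e n x y -> gdist e x y <= n.
Proof.
move=> hn; have [ltnT|leTn] := ltnP n #|T|; last first.
  by apply: leq_trans leTn; rewrite -[X in _ <= X](size_iota 0) find_size.
rewrite leqNgt; apply/negP => /(before_find 0).
by rewrite nth_iota // add0n hn.
Qed.

Lemma gdist_walk (x y : T) : has_walk e (gdist e x y) x y.
Proof.
have hasw : has (fun n => has_walk e n x y) (iota 0 #|T|).
  have /connectP[p ep ->] := e_conn x y.
  (* Only a walk without repeated vertices is known to have fewer than [#|T|] steps, as the search
     range of [gdist] requires. *)
  case: (shortenP ep) => p' ep' up' _.
  apply/hasP; exists (size p'); last by apply/has_walkP; exists p'.
  rewrite mem_iota add0n; have := max_card (mem (x :: p')).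
  by rewrite (card_uniqP up').
have := nth_find 0 hasw; rewrite nth_iota ?add0n //.
by rewrite -[X in _ < X](size_iota 0) -has_find.
Qed.

Lemma gdistxx (x : T) : gdist e x x = 0.
Proof.
by apply/eqP; rewrite -leqn0; apply/gdist_le/has_walkP; exists [::].
Qed.

Lemma gdist_eq0 (x y : T) : (gdist e x y == 0) = (x == y).
Proof.
apply/eqP/eqP => [d0|->]; last exact: gdistxx.
by have := gdist_walk x y; rewrite d0 => /has_walkP[[|? ?] [//]].
Qed.

Lemma gdist_leC (x y : T) : gdist e x y <= gdist e y x.
Proof.
have /has_walkP[p [sp ep lp]] := gdist_walk y x.
apply/gdist_le/has_walkP; exists (rev (belast y p)); split.
- by rewrite size_rev size_belast.
- rewrite -lp rev_path; apply: sub_path ep => a b.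
  by rewrite /= e_sym.
- by case: p {sp ep} lp => //= a p _; rewrite rev_cons last_rcons.
Qed.

Lemma gdistC (x y : T) : gdist e x y = gdist e y x.
Proof. by apply/eqP; rewrite eqn_leq !gdist_leC. Qed.

Lemma gdist_step (x y z : T) : e y z -> gdist e x z <= (gdist e x y).+1.
Proof.
move=> eyz; have /has_walkP[p [sp ep lp]] := gdist_walk x y.
apply/gdist_le/has_walkP; exists (rcons p z).
by rewrite size_rcons sp rcons_path ep lp last_rcons.
Qed.

Lemma gdist_pred (n : nat) (x y : T) :
  gdist e x y = n.+1 -> exists2 z, e z y & gdist e x z = n.
Proof.
move=> dn; have := gdist_walk x y; rewrite dn => /has_walkP[p []].
case/lastP: p => // p z; rewrite size_rcons rcons_path last_rcons.
move=> [sp] /andP[ep ez] zy; rewrite {z}zy in ez.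
exists (last x p) => //; apply/eqP; rewrite eqn_leq; apply/andP; split.
  by apply/gdist_le/has_walkP; exists p.
by rewrite -ltnS -dn gdist_step.
Qed.

End GraphDistance.

(** * Metric geometry of near polygons *)

Section NearPolygon.

Variables (P L : finType) (inc : P -> L -> bool) (d : nat).
Hypothesis np : near_polygon inc d.

Local Notation dist := (pdist inc).
Local Notation adj := (collinear inc).

Lemma collinear_sym : symmetric adj.
Proof.
move=> x y; rewrite /collinear /= eq_sym; congr (_ && _).
by apply: eq_existsb => l; rewrite andbC.
Qed.

Lemma collinearP (x y : P) :
  reflect (x <> y /\ exists l, inc x l /\ inc y l) (adj x y).
Proof.
apply: (iffP andP) => [[/eqP nxy /existsP[l /andP[xl yl]]]|].
  by split=> //; exists l.
by case=> /eqP nxy [l [xl yl]]; split=> //; apply/existsP; exists l; rewrite xl.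
Qed.

Lemma collinear_conn : gconnected adj.
Proof. by case: np. Qed.

Lemma pdistxx (x : P) : dist x x = 0.
Proof. exact: gdistxx. Qed.

Lemma pdist_eq0 (x y : P) : (dist x y == 0) = (x == y).
Proof. exact: gdist_eq0 collinear_conn _ _. Qed.

Lemma pdistC (x y : P) : dist x y = dist y x.
Proof. exact: gdistC collinear_sym collinear_conn _ _. Qed.

Lemma pdist_adj (x y z : P) : adj y z -> dist x z <= (dist x y).+1.
Proof. exact: (gdist_step collinear_conn). Qed.

Lemma pdist_adjl (x y z : P) : adj x y -> dist x z <= (dist y z).+1.
Proof. by rewrite collinear_sym (pdistC x) (pdistC y); exact: pdist_adj. Qed.

Lemma pdist_pred (n : nat) (x y : P) :
  dist x y = n.+1 -> exists2 z, adj z y & dist x z = n.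
Proof. exact: (gdist_pred collinear_conn). Qed.

Lemma pdist_adj1 (x y : P) : adj x y -> dist x y = 1.
Proof.
move=> axy; apply/eqP; rewrite eqn_leq -{1}(pdistxx x) pdist_adj //=.
by rewrite lt0n pdist_eq0; case/andP: axy.
Qed.

Lemma adj_pdist1 (x y : P) : dist x y = 1 -> adj x y.
Proof. by case/pdist_pred => z azy /eqP; rewrite pdist_eq0 => /eqP ->. Qed.

Lemma leq_pdist_diam (x y : P) : dist x y <= d.
Proof.
case: np => _ _ _ <- _; rewrite /diameter.
by apply: leq_trans (leq_bigmax x); apply: leq_bigmax.
Qed.

(** Start from a pair at distance [d] and move [y] back along a shortest walk. *)
Lemma exists_pdist (j : nat) : j <= d -> exists x y, dist x y = j.
Proof.
move=> lejd; rewrite -(subKn lejd); elim: (d - j) => [|n [x [y dxy]]].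
  case: np => d2 _ _ dd _; have P0 : 0 < #|P|.
    rewrite lt0n; apply/eqP => /card0_eq P0; move: dd d2.
    by rewrite /diameter big_pred0 // => <-.
  have [x dx] := bigop.eq_bigmax (fun x => \max_y dist x y) P0.
  have [y dy] := bigop.eq_bigmax (fun y => dist x y) P0.
  by exists x, y; rewrite -dy -dx subn0.
have [lt|ge] := ltnP n d; last by exists x, y; rewrite dxy; lia.
have [|z _ dz] := @pdist_pred (d - n.+1) x y; first by rewrite dxy; lia.
by exists x, z.
Qed.

(** Every point of [l] other than [p] is adjacent to [p], hence at most one step farther from [x],
    and by uniqueness of the nearest point it is strictly farther. This is the working form of the
    near polygon axiom. *)
Lemma line_nearest (x : P) (l : L) :
  exists2 p, inc p l & forall z, inc z l -> dist x z = dist x p + (z != p).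
Proof.
case: np => _ _ _ _ /(_ x l)[p [[pl ple] puniq]]; exists p => // z zl.
have [->|/eqP nzp] := eqVneq z p; first by rewrite addn0.
apply/eqP; rewrite addn1 eqn_leq pdist_adj; last first.
  by apply/collinearP; split; [exact/nesym | exists l].
rewrite ltnNge; apply/negP => dle; apply: nzp; apply/esym/puniq; split=> // z' z'l.
exact: leq_trans dle (ple _ z'l).
Qed.

(** If [u] and [v] were on a line, that line would pass through [x], since no line has two points
    nearest to [x]. It would then hold points at distances [n], [n], [n.+1] from [y], which
    [line_nearest] excludes. *)
Lemma pdist2 (n : nat) (x y u v : P) :
    adj x u -> adj x v -> u <> v -> dist y u = n -> dist y v = n ->
  dist y x = n.+1 -> dist u v = 2.
Proof.
move=> axu axv nuv du dv dx.
have := pdist_adjl v (etrans (collinear_sym u x) axu); rewrite (pdist_adj1 axv) => le2.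
have: dist u v != 0 by rewrite pdist_eq0; exact/eqP.
suff: dist u v <> 1 by lia.
move=> /adj_pdist1/collinearP[_ [l [ul vl]]].
have nuv' p : (u == p) && (v == p) = false.
  by apply/negP => /andP[/eqP eu /eqP ev]; apply: nuv; rewrite eu.
have xl : inc x l.
  have [p pl hp] := line_nearest x l.
  have := hp _ ul; have := hp _ vl; rewrite (pdist_adj1 axu) (pdist_adj1 axv).
  move=> e1 e2; have /eqP : dist x p = 0.
    by move: (nuv' p) e1 e2; case: (u == p); case: (v == p) => //=; lia.
  by rewrite pdist_eq0 => /eqP ->.
have [p pl hp] := line_nearest y l.
have := hp _ xl; have := hp _ ul; have := hp _ vl; rewrite du dv dx.
have := nuv' p; case: (u == p); case: (v == p); case: eqP => //= _ _; lia.
Qed.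

(** The set S(x,y) of the opening comment. *)
Definition steps_toward (x y : P) : pred P :=
  [pred u | adj x u && ((dist u y).+1 == dist x y)].

(** Sending [u] to the line through [x] and [u] is a bijection: a line on [x] that gets closer to
    [y] has just one point nearest to [y]. *)
Lemma card_steps_toward (x y : P) :
  #|steps_toward x y| = #|lines_toward inc y x (dist y x)|.
Proof.
pose f u := [pick l | inc x l && inc u l].
have fP u : u \in steps_toward x y -> exists2 l, f u = Some l & inc x l && inc u l.
  case/andP => /collinearP[_ [l [xl ul]]] _; rewrite /f.
  by case: pickP => [l' ? | /(_ l)]; [exists l' | rewrite xl ul].
rewrite -(card_in_imset (f := f)).
  rewrite -[RHS](card_imset _ (@Some_inj _)); apply: eq_card => o; apply/imsetP/imsetP.
  - case=> u hu ->; have [l -> /andP[xl ul]] := fP _ hu; exists l => //.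
    rewrite !inE xl; apply/existsP; exists u; rewrite ul pdistC (pdistC y).
    by case/andP: hu.
  - case=> l; rewrite !inE => /andP[xl /existsP[u /andP[ul du]]] ->.
    have nxu : x <> u by move=> e; move: du; rewrite e; lia.
    have hu : u \in steps_toward x y.
      rewrite inE pdistC (pdistC x) du andbT.
      by apply/collinearP; split=> //; exists l.
    exists u => //; have [l' -> /andP[xl' ul']] := fP _ hu.
    by case: np => _ pl _ _ _; rewrite (pl x u l l').
move=> u v hu hv; have [l -> /andP[xl ul]] := fP _ hu.
have [l' -> /andP[_ vl]] := fP _ hv; move=> [e]; rewrite -{}e in vl.
move: hu hv; rewrite !inE => /andP[_ /eqP du] /andP[_ /eqP dv].
have [p pl hp] := line_nearest y l.
have := hp _ xl; have := hp _ ul; have := hp _ vl.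
move: du dv; rewrite !(pdistC _ y).
case: (eqVneq u p) => [->|_]; case: (eqVneq v p) => [->//|_]; case: (x != p); lia.
Qed.

(** Let i be the distance of [x] and [y]. On the line through [y] and [v], the point nearest to [x]
    is [v]. A third point nearest to [u] would be at distance i - 2 from [u], so at most i - 1 from
    [x], which only [v] is. Hence [y] or [v] is nearest to [u], and the distance i - 1 never
    occurs. *)
Lemma steps_toward_pdist (x y u v : P) :
  u \in steps_toward x y -> v \in steps_toward y x ->
  dist u v = if v \in steps_toward y u then (dist x y).-2 else dist x y.
Proof.
rewrite !inE => /andP[axu /eqP du] /andP[ayv /eqP dv].
rewrite ayv /= (pdistC v u) (pdistC y u); case: eqP => [|nduv]; first by lia.
move: dv; rewrite !(pdistC _ x) => dv.
have /collinearP[nyv [l [yl vl]]] := ayv.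
have [p pl hp] := line_nearest u l; have [p' pl' hp'] := line_nearest x l.
have := hp _ yl; have := hp _ vl.
have := hp' _ pl; have := hp' _ yl; have := hp' _ vl.
have := pdist_adjl p axu.
case: (eqVneq y p) => [<-|_].
  by case: (eqVneq v y) => [e|_]; [case: nyv | lia].
case: (eqVneq v p) => [<-|nvp]; first by case: (_ != p'); case: (_ != p'); lia.
case: (eqVneq p p') nvp => [<- /negbTE -> |_ _]; last by lia.
by case: (y != p); case: (v != p'); lia.
Qed.

End NearPolygon.

Local Open Scope ring_scope.

(** * Functions summing to zero on every line *)

Section ZeroOnLines.

Variables (P L : finType) (inc : P -> L -> bool).

Definition zero_on_lines (f : P -> rat) : Prop :=
  forall l : L, \sum_(x | inc x l) f x = 0.

(** Double counting of [f] over the flags whose line is in [M]: line by line the total is 0, point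
    by point it is the left-hand side, as the lines of [M] stay inside [A] and [B]. *)
Lemma sum_two_classes (A B : pred P) (M : pred L) (a b : rat) (f : P -> rat) :
    zero_on_lines f ->
    (forall z, A z -> B z = false) ->
    (forall z l, M l -> inc z l -> A z || B z) ->
    (forall z, A z -> #|[pred l | inc z l && M l]|%:R = a) ->
    (forall z, B z -> #|[pred l | inc z l && M l]|%:R = b) ->
  a * (\sum_(z | A z) f z) + b * (\sum_(z | B z) f z) = 0.
Proof.
move=> f0 disj MAB cA cB.
have: \sum_(l | M l) \sum_(z | inc z l) f z = 0 by rewrite big1.
rewrite (exchange_big_dep xpredT) //= => e; rewrite -[RHS]e {e}.
rewrite [RHS](bigID A) /= [X in _ = _ + X](bigID B) /= !mulr_sumr.
have eqs z : \sum_(l | M l && inc z l) f z = #|[pred l | inc z l && M l]|%:R * f z.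
  rewrite mulr_natl -sumr_const; apply: eq_bigl => l.
  by rewrite !inE andbC.
rewrite [X in _ = _ + (_ + X)]big1 ?addr0; last first.
  move=> z /andP[nA nB]; rewrite big_pred0 // => l.
  by apply/negP => /andP[Ml zl]; move: (MAB _ _ Ml zl); rewrite (negbTE nA) (negbTE nB).
congr (_ + _).
  by apply: eq_bigr => z Az; rewrite eqs cA.
rewrite [RHS](eq_bigl B) => [|z]; last by case Az: (A z) => //=; rewrite disj.
by apply: eq_bigr => z Bz; rewrite eqs cB.
Qed.

End ZeroOnLines.

(** * Parameters of a regular near polygon *)

Section RegularNearPolygon.

Variables (P L : finType) (inc : P -> L -> bool) (d s t : nat) (ti : nat -> int).
Hypothesis hS : regular_near_polygon inc d s t ti.

Local Notation dist := (pdist inc).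
Local Notation adj := (collinear inc).
Local Notation tau j := ((ti j)%:~R + 1 : rat).

Lemma regular_near : near_polygon inc d. Proof. by case: hS. Qed.
Let np := regular_near.

Lemma card_lines_toward (x y : P) :
  #|lines_toward inc x y (dist x y)|%:R = tau (dist x y).
Proof.
case: hS => _ _ _ /(_ _ x y erefl) /(congr1 (fun z => z%:~R : rat)).
by rewrite rmorphD /= => <-.
Qed.

Lemma card_steps (x y : P) : #|steps_toward inc x y|%:R = tau (dist x y).
Proof. by rewrite (card_steps_toward np) card_lines_toward (pdistC np). Qed.

Lemma tau0 : tau 0%N = 0.
Proof. by case: hS => _ _ [-> _ _] _. Qed.

Lemma tau1 : tau 1%N = 1.
Proof. by case: hS => _ _ [_ -> _] _. Qed.

Lemma tau_gt0 (j : nat) : (0 < j <= d)%N -> 0 < tau j.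
Proof.
case: j => // j /(exists_pdist np)[x [y dxy]]; rewrite -dxy -card_steps ltr0n.
rewrite (pdistC np) in dxy.
have [z azx dz] := pdist_pred np dxy; apply/card_gt0P; exists z.
by rewrite inE collinear_sym azx (pdistC np z) dz (pdistC np x) dxy /=.
Qed.

Lemma card_lines_away (x y : P) :
  #|lines_on inc y :\: lines_toward inc x y (dist x y)|%:R
    = t%:R + 1 - tau (dist x y).
Proof.
rewrite -card_lines_toward; have [_ [_ /(_ y) ct] _ _] := hS.
have sub : lines_toward inc x y (dist x y) \subset lines_on inc y.
  by apply/subsetP => l; rewrite inE => /andP[].
by rewrite cardsDS // ct natrB -?natr1 // -ct subset_leq_card.
Qed.

(** As [j < d], some [z] at distance [j] from [x] has a neighbour [y] at distance [j.+1], and the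
    line through [z] and [y] does not lead toward [x]. *)
Lemma tau_lt (j : nat) : (j < d)%N -> tau j < t%:R + 1.
Proof.
move=> /(exists_pdist np)[x [y dxy]].
have [z azy dz] := pdist_pred np dxy; rewrite -subr_gt0 -dz -card_lines_away.
rewrite ltr0n; apply/card_gt0P.
have /collinearP[nzy [l [zl yl]]] := azy.
exists l; rewrite !inE zl /= andbT.
apply/negP => /existsP[v /andP[vl /eqP dv]].
have [p pl hp] := line_nearest np x l.
by have := hp _ vl; have := hp _ zl; have := hp _ yl; lia.
Qed.

(** * Sums over spheres and over the points seen past an edge *)

Lemma sphere_rec (f : P -> rat) (x : P) (j : nat) : zero_on_lines inc f ->
  (t%:R + 1 - tau j) * (\sum_(z | dist x z == j) f z)
    + tau j.+1 * (\sum_(z | dist x z == j.+1) f z) = 0.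
Proof.
move=> f0; apply: (sum_two_classes
  (M := [pred l | [exists z, inc z l && (dist x z == j)] &&
          [forall z, inc z l ==> (dist x z == j) || (dist x z == j.+1)]])) => //.
- by move=> z /eqP ->; lia.
- by move=> z l /andP[_ /forallP/(_ z)/implyP].
- move=> z /eqP dz; rewrite -dz -card_lines_away dz; congr _%:R.
  apply: eq_card => l; rewrite !inE; case zl: (inc z l); rewrite ?andbF //= andbT.
  have [p pl hp] := line_nearest np x l.
  apply/andP/negP => [[_ /forallP al] /existsP[v /andP[vl dv]]|nex].
    by have := al v; rewrite vl; lia.
  split; first by apply/existsP; exists z; rewrite zl dz eqxx.
  apply/forallP => v; apply/implyP => vl; have := hp _ vl; have := hp _ zl.
  have : (dist x p).+1 != j.
    by apply/negP => dp; apply/nex/existsP; exists p; rewrite pl dp.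
  by lia.
- move=> z /eqP dz; rewrite -dz -card_lines_toward; congr _%:R.
  apply: eq_card => l; rewrite !inE; case zl: (inc z l); rewrite //=.
  have [p pl hp] := line_nearest np x l.
  apply/andP/existsP => [[/existsP[v /andP[vl dv]] _]|[v /andP[vl dv]]].
    by exists v; rewrite vl dz; lia.
  split; first by apply/existsP; exists v; rewrite vl; lia.
  apply/forallP => w; apply/implyP => wl.
  by have := hp _ vl; have := hp _ zl; have := hp _ wl; lia.
Qed.

(** The lines counted have a common nearest point to [u] and [x], at distances [j] and [j.+1].
    Through a point of the inner class they are the lines leading away from [x], which then lead
    away from [u] too; through a point of the outer class they are the lines toward [u], which then
    lead toward [x] too. *)
Lemma edge_rec (f : P -> rat) (x u : P) (j : nat) :
    zero_on_lines inc f -> adj x u ->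
  (t%:R + 1 - tau j.+1) * (\sum_(z | (dist u z == j) && (dist x z == j.+1)) f z)
    + tau j.+1 * (\sum_(z | (dist u z == j.+1) && (dist x z == j.+2)) f z) = 0.
Proof.
move=> f0 axu.
have lexu z := pdist_adjl np z axu.
apply: (sum_two_classes
  (M := [pred l | [exists z, inc z l && ((dist u z == j) && (dist x z == j.+1))] &&
          [forall z, inc z l ==> ((dist u z == j) && (dist x z == j.+1))
             || ((dist u z == j.+1) && (dist x z == j.+2))]])) => //.
- by move=> z; lia.
- by move=> z l /andP[_ /forallP/(_ z)/implyP].
- move=> z /andP[/eqP du /eqP dz]; rewrite -dz -card_lines_away dz; congr _%:R.
  apply: eq_card => l; rewrite !inE; case zl: (inc z l); rewrite ?andbF //= andbT.
  have [p pl hp] := line_nearest np x l; have [p' pl' hp'] := line_nearest np u l.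
  apply/andP/negP => [[_ /forallP al] /existsP[v /andP[vl dv]]|nex].
    by have := al v; rewrite vl; lia.
  split; first by apply/existsP; exists z; rewrite zl dz du !eqxx.
  have npj : (dist x p).+1 != j.+1.
    by apply/negP => dp; apply/nex/existsP; exists p; rewrite pl dp.
  have ezp : z = p by apply/eqP; have := hp _ zl; lia.
  apply/forallP => v; apply/implyP => vl; have := hp _ vl.
  have := hp' _ vl; have := hp' _ zl; have := lexu v; rewrite -ezp.
  by case: (eqVneq v z) => [->|_]; lia.
- move=> z /andP[/eqP du /eqP dz]; rewrite -du -card_lines_toward; congr _%:R.
  apply: eq_card => l; rewrite !inE; case zl: (inc z l); rewrite //=.
  have [p pl hp] := line_nearest np x l; have [p' pl' hp'] := line_nearest np u l.
  apply/andP/existsP => [[/existsP[v /andP[vl /andP[dv _]]] _]|[v /andP[vl]]].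
    by exists v; rewrite vl du (eqP dv) eqxx.
  rewrite du eqSS => /eqP dv.
  have dxv : dist x v = j.+1 by have := hp _ vl; have := hp _ zl; have := lexu v; lia.
  have evp : p = v by apply/eqP; rewrite eq_sym; have := hp _ vl; have := hp _ zl; lia.
  have evp' : p' = v.
    by apply/eqP; rewrite eq_sym; have := hp' _ vl; have := hp' _ zl; lia.
  split; first by apply/existsP; exists v; rewrite vl dv dxv !eqxx.
  apply/forallP => w; apply/implyP => wl.
  rewrite (hp _ wl) (hp' _ wl) evp evp' dv dxv.
  by case: (w == v); rewrite ?addn0 ?addn1 !eqxx ?orbT.
Qed.

(** For [j <= d], the eigenvalue of the distance-[j] matrix on the functions vanishing on lines,
    obtained by unrolling [sphere_rec]; [edge_coef] unrolls [edge_rec]. *)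
Definition sphere_coef (j : nat) : rat :=
  \prod_(k < j) - ((t%:R + 1 - tau k) / tau k.+1).

Definition edge_coef (j : nat) : rat :=
  \prod_(k < j) - ((t%:R + 1 - tau k.+1) / tau k.+1).

Lemma sphere_sum (f : P -> rat) (x : P) (j : nat) :
    zero_on_lines inc f -> (j <= d)%N ->
  \sum_(z | dist x z == j) f z = sphere_coef j * f x.
Proof.
move=> f0; elim: j => [|j IHj] lejd.
  rewrite /sphere_coef big_ord0 mul1r (big_pred1 x) // => z.
  by rewrite (pdist_eq0 np) eq_sym.
have tgt := tau_gt0 (j := j.+1) lejd.
have := sphere_rec x j f0; rewrite IHj 1?ltnW //.
rewrite /sphere_coef big_ord_recr /= => e.
apply: (mulfI (lt0r_neq0 tgt)); move/eqP: e; rewrite addrC addr_eq0 => /eqP ->.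
by field; rewrite lt0r_neq0.
Qed.

Lemma edge_sum (f : P -> rat) (x u : P) (j : nat) :
    zero_on_lines inc f -> adj x u -> (j < d)%N ->
  \sum_(z | (dist u z == j) && (dist x z == j.+1)) f z = edge_coef j * f u.
Proof.
move=> f0 axu; elim: j => [|j IHj] ltjd.
  rewrite /edge_coef big_ord0 mul1r (big_pred1 u) // => z.
  rewrite (pdist_eq0 np) eq_sym /=; have [->|//] := eqVneq z u.
  by rewrite (pdist_adj1 np axu).
have tgt := tau_gt0 (j := j.+1) (ltnW ltjd).
have := edge_rec j f0 axu; rewrite IHj 1?ltnW //.
rewrite /edge_coef big_ord_recr /= => e.
apply: (mulfI (lt0r_neq0 tgt)); move/eqP: e; rewrite addrC addr_eq0 => /eqP ->.
by field; rewrite lt0r_neq0.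
Qed.

(** The product stops before the factor with t + 1 - [tau d], which is 0. *)
Lemma edge_coef_neq0 (j : nat) : (j < d)%N -> edge_coef j != 0.
Proof.
move=> ltjd; apply/prodf_neq0 => k _; have ltkd : (k.+1 < d)%N by have := ltn_ord k; lia.
rewrite oppr_eq0 mulf_neq0 ?invr_neq0 ?lt0r_neq0 //.
  by rewrite subr_gt0 tau_lt.
by rewrite tau_gt0 //= ltnW.
Qed.

(** After a shift of the numerators, the two products differ by one sign, by the numerator t + 1 at
    [k = 0] and by the last denominator [tau j.+1]. *)
Lemma sphere_edge_coef (j : nat) : (j < d)%N ->
  sphere_coef j.+1 * tau j.+1 = - (t%:R + 1) * edge_coef j.
Proof.
elim: j => [|j IHj] ltjd.
  by rewrite /sphere_coef /edge_coef big_ord1 big_ord0 tau0 tau1; field.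
have t1 := tau_gt0 (j := j.+1) (ltnW ltjd).
have t2 := tau_gt0 (j := j.+2) ltjd.
rewrite /sphere_coef big_ord_recr /edge_coef [in RHS]big_ord_recr /=.
rewrite -/(sphere_coef j.+1) -/(edge_coef j) mulrA -IHj 1?ltnW //.
by field; rewrite !lt0r_neq0.
Qed.

Lemma order_s_gt0 : (0 < s)%N.
Proof.
have [x [y dxy]] : exists x y, dist x y = 1%N.
  by apply: (exists_pdist np); case: np => /ltnW.
have /(adj_pdist1 np)/collinearP[nxy [l [xl yl]]] := dxy.
case: hS => _ [/(_ l) cl _] _ _.
rewrite -ltnS -cl; apply: leq_trans (_ : #|[set x; y]| <= _)%N.
  by rewrite cards2; case: eqP.
by apply: subset_leq_card; apply/subsetP => z; rewrite !inE => /orP[] /eqP ->.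
Qed.

(** * The functions E_x and their Gram matrix *)

Local Notation q := (- s%:R^-1 : rat).

Definition powdist (x z : P) : rat := q ^+ dist x z.

(** The nearest point contributes q^n, each of the [s] others q^(n+1), and 1 + s q = 0. *)
Lemma powdist_zero (x : P) : zero_on_lines inc (powdist x).
Proof.
move=> l; have [p pl hp] := line_nearest np x l.
rewrite (bigD1 p) //= (eq_bigr (fun=> q ^+ (dist x p).+1)) => [|z /andP[zl nzp]].
  rewrite sumr_const (_ : #|_| = s).
    rewrite /powdist exprS -mulr_natl; field.
    by rewrite pnatr_eq0 -lt0n order_s_gt0.
  case: hS => _ [/(_ l) cl _] _ _; apply/eqP; rewrite -eqSS -cl (cardsD1 p).
  rewrite inE pl add1n eqSS; apply/eqP/eq_card => z.
  by rewrite !inE andbC.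
by rewrite /powdist hp // nzp addn1.
Qed.

Definition powdist_norm : rat := \sum_(j < d.+1) q ^+ j * sphere_coef j.

(** Group the points by their distance from [x] and apply [sphere_sum]. Thus [powdist] is a
    reproducing kernel up to the scalar [powdist_norm]. *)
Lemma powdist_dot (f : P -> rat) (x : P) : zero_on_lines inc f ->
  \sum_z powdist x z * f z = powdist_norm * f x.
Proof.
move=> f0; rewrite /powdist_norm mulr_suml.
rewrite (partition_big (fun z => inord (dist x z) : 'I_d.+1) xpredT) //=.
apply: eq_bigr => j _; rewrite -mulrA -sphere_sum ?mulr_sumr; last 2 first.
- exact: f0.
- by rewrite -ltnS.
have ordE z : (inord (dist x z) == j) = (dist x z == j).
  by rewrite -val_eqE /= inordK // ltnS (leq_pdist_diam np).
rewrite (eq_bigl _ _ ordE); apply: eq_bigr => z /eqP dz.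
by rewrite /powdist dz.
Qed.

(** It is the squared norm of [powdist x], whose value at [x] is 1. *)
Lemma powdist_norm_neq0 : powdist_norm != 0.
Proof.
have [x [y dxy]] := exists_pdist np (leq0n d).
have := powdist_dot x (powdist_zero x); rewrite /powdist pdistxx mulr1.
move=> <-; rewrite (bigD1 x) //= pdistxx mulr1 lt0r_neq0 //.
by rewrite ltr_pwDl // sumr_ge0 // => z _; rewrite -expr2 sqr_ge0.
Qed.

(** Let g be the combination of the [powdist l] with coefficients [c l] (here [l] is a point). Its
    squared norm is a multiple of the sum of c g, which is 0 because g vanishes on the support of
    [c]. So g = 0, and pairing g with [f] gives the claim. *)
Lemma powdist_span_eq0 (c f : P -> rat) : zero_on_lines inc f ->
    (forall k, c k != 0 -> \sum_l c l * powdist l k = 0) ->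
  \sum_l c l * f l = 0.
Proof.
move=> f0 gram0; pose g z := \sum_l c l * powdist l z.
have dotg h : zero_on_lines inc h ->
    \sum_z g z * h z = powdist_norm * \sum_l c l * h l.
  move=> h0; rewrite mulr_sumr.
  rewrite (eq_bigr (fun z => \sum_l c l * (powdist l z * h z))); last first.
    by move=> z _; rewrite mulr_suml; apply: eq_bigr => l _; rewrite mulrA.
  rewrite exchange_big /=; apply: eq_bigr => l _.
  by rewrite -mulr_sumr powdist_dot // mulrCA.
have g0 : zero_on_lines inc g.
  move=> l; rewrite exchange_big /= big1 // => k _.
  by rewrite -mulr_sumr powdist_zero mulr0.
have gz z : g z = 0.
  have : \sum_z g z ^+ 2 = 0.
    under eq_bigr do rewrite expr2.
    rewrite dotg // big1 ?mulr0 // => l _.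
    by have [->|/gram0 gl] := eqVneq (c l) 0; rewrite ?mul0r // [g l]gl mulr0.
  move/eqP; rewrite psumr_eq0 => [/allP/(_ z)|k _]; last exact: sqr_ge0.
  by rewrite mem_index_enum sqrf_eq0 => /(_ isT)/eqP.
apply: (mulfI powdist_norm_neq0); rewrite -dotg // mulr0 big1 // => z _.
by rewrite gz mul0r.
Qed.

(** * The linear relation between S(x,y), S(y,x), x and y *)

Lemma sum_powdist_steps (x y u : P) : (1 < dist x y)%N ->
    u \in steps_toward inc x y ->
  \sum_(v in steps_toward inc x y) powdist v u
    = 1 + (tau (dist x y) - 1) * q ^+ 2.
Proof.
move=> d1 uS; rewrite (bigD1 u) //= /powdist pdistxx expr0; congr (_ + _).
rewrite (eq_bigr (fun=> q ^+ 2)) => [|v /andP[vS /eqP nvu]].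
  rewrite sumr_const -[LHS]mulr_natl -card_steps [in RHS](cardD1 u) uS.
  rewrite natrD addrAC subrr add0r; congr (_%:R * _).
  by apply: eq_card => v; rewrite !inE andbC.
move: uS vS; rewrite !inE => /andP[axu /eqP du] /andP[axv /eqP dv].
rewrite (pdist2 np (n := (dist x y).-1) axv axu nvu (y := y)) //;
  rewrite !(pdistC np y); lia.
Qed.

(** By [steps_toward_pdist], S(y,x) splits into its subset S(y,u), at distance i - 2 from [u], and
    the rest, at distance i, where i is the distance of [x] and [y]. *)
Lemma sum_powdist_opposite (x y u : P) : (1 < dist x y)%N ->
    u \in steps_toward inc x y ->
  \sum_(v in steps_toward inc y x) powdist v u
    = tau (dist x y).-1 * q ^+ (dist x y).-2
      + (tau (dist x y) - tau (dist x y).-1) * q ^+ dist x y.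
Proof.
move=> d1 uS; have [axu /eqP du] := andP uS.
have duy : (dist y u = (dist x y).-1)%N by rewrite (pdistC np); lia.
have sub v : v \in steps_toward inc y u -> v \in steps_toward inc y x.
  rewrite !inE => /andP[ayv /eqP dv]; rewrite ayv /=.
  have := pdist_adjl np x ayv; have := pdist_adjl np v axu.
  by rewrite (pdistC np y x) (pdistC np x v) (pdistC np u v); lia.
rewrite (bigID (mem (steps_toward inc y u))) /=.
rewrite (eq_bigr (fun=> q ^+ (dist x y).-2)) => [|v /andP[vS vT]]; last first.
  by rewrite /powdist (pdistC np) (steps_toward_pdist np uS vS) vT.
rewrite [X in _ + X](eq_bigr (fun=> q ^+ dist x y)) =>
    [|v /andP[vS /negbTE vT]]; last first.
  by rewrite /powdist (pdistC np) (steps_toward_pdist np uS vS) vT.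
rewrite !sumr_const -!(mulr_natl (q ^+ _)).
have c1 : #|[pred v | v \in steps_toward inc y x & v \in steps_toward inc y u]|%:R
    = tau (dist x y).-1.
  rewrite -duy -card_steps; congr _%:R; apply: eq_card => v; rewrite inE.
  by case: (boolP (v \in steps_toward inc y u)) => [/sub ->|]; rewrite ?andbF.
have := card_steps y x; rewrite (pdistC np y x) => <-.
rewrite -c1; congr (_ * _ + _ * _).
rewrite -(cardID (mem (steps_toward inc y u)) (steps_toward inc y x)) natrD.
rewrite (_ : #|[predI _ & _]| =
  #|[pred v | v \in steps_toward inc y x & v \in steps_toward inc y u]|) //.
rewrite addrAC subrr add0r; congr _%:R; apply: eq_card => v.
by rewrite !inE andbC.
Qed.

(** The two equations on [kappa] say that the combination with coefficients [c] vanishes at [x] and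
    [y], respectively on S(x,y) and S(y,x). These points contain the support of [c], so
    [powdist_span_eq0] applies. *)
Lemma steps_relation (f : P -> rat) (x y : P) (kappa : rat) :
    zero_on_lines inc f -> (1 < dist x y)%N ->
    kappa * (1 + q ^+ dist x y)
      = tau (dist x y) * (q + q ^+ (dist x y).-1) ->
    kappa * (q + q ^+ (dist x y).-1)
      = 1 + (tau (dist x y) - 1) * q ^+ 2 + tau (dist x y).-1 * q ^+ (dist x y).-2
        + (tau (dist x y) - tau (dist x y).-1) * q ^+ dist x y ->
  \sum_(u in steps_toward inc x y) f u + \sum_(v in steps_toward inc y x) f v
    = kappa * (f x + f y).
Proof.
move=> f0 d1 k1 k2; pose S := steps_toward inc x y; pose S' := steps_toward inc y x.
pose c z : rat := (z \in S)%:R + (z \in S')%:R - kappa * ((z == x)%:R + (z == y)%:R).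
have sum_c h : \sum_z c z * h z
    = \sum_(u in S) h u + \sum_(v in S') h v - kappa * (h x + h y).
  have sum_mem (A : pred P) : \sum_z (A z)%:R * h z = \sum_(z in A) h z.
    by rewrite [RHS]big_mkcond; apply: eq_bigr => z _; rewrite unfold_in;
      case: (A z); rewrite ?mul1r ?mul0r.
  rewrite (eq_bigr (fun z => (z \in S)%:R * h z + (z \in S')%:R * h z
     - kappa * ((z == x)%:R * h z + (z == y)%:R * h z))) => [|z _]; last first.
    by rewrite /c; ring.
  rewrite sumrB -mulr_sumr !big_split /=.
  rewrite (sum_mem S) (sum_mem S') (sum_mem (pred1 x)) (sum_mem (pred1 y)).
  by rewrite [\sum_(z in pred1 x) _](big_pred1 x) // [\sum_(z in pred1 y) _](big_pred1 y).
(* Used to exchange the roles of [x] and [y]. *)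
have sgn u v (A B : rat) : A + B - kappa * (u + v) = A + B - kappa * (v + u) by ring.
have gram_end (a b : P) : dist a b = dist x y ->
    \sum_(u in steps_toward inc a b) powdist u a
    + \sum_(v in steps_toward inc b a) powdist v a
    - kappa * (powdist a a + powdist b a) = 0.
  move=> dab; rewrite /powdist pdistxx expr0 (pdistC np b a) dab k1.
  rewrite (eq_bigr (fun=> q)) => [|u]; last first.
    by rewrite inE (pdistC np u a) => /andP[/(pdist_adj1 np) -> _].
  rewrite [X in _ + X - _](eq_bigr (fun=> q ^+ (dist x y).-1)) => [|v]; last first.
    by rewrite inE => /andP[_ /eqP]; rewrite (pdistC np b) dab => <-.
  rewrite !sumr_const -!(mulr_natl q) -(mulr_natl (q ^+ _)) !card_steps.
  by rewrite (pdistC np b a) dab; ring.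
have gram_mid (a b u : P) : dist a b = dist x y -> u \in steps_toward inc a b ->
    \sum_(u' in steps_toward inc a b) powdist u' u
    + \sum_(v in steps_toward inc b a) powdist v u
    - kappa * (powdist a u + powdist b u) = 0.
  move=> dab uS; rewrite sum_powdist_steps ?sum_powdist_opposite ?dab //.
  move: uS; rewrite inE /powdist => /andP[/(pdist_adj1 np) -> /eqP].
  rewrite (pdistC np b) dab => du; have -> : (dist u b = (dist x y).-1)%N by lia.
  by rewrite expr1 k2; ring.
apply/eqP; rewrite -subr_eq0 -sum_c; apply/eqP.
apply: powdist_span_eq0 => // k ck0; rewrite sum_c.
have [->|nkx] := eqVneq k x; first exact: gram_end.
have [->|nky] := eqVneq k y.
  by rewrite sgn [X in X - _]addrC gram_end // (pdistC np).
have [kS|nkS] := boolP (k \in S); first exact: gram_mid.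
have [kS'|nkS'] := boolP (k \in S').
  by rewrite sgn [X in X - _]addrC gram_mid // (pdistC np).
move: ck0; rewrite /c (negbTE nkx) (negbTE nky) (negbTE nkS) (negbTE nkS').
by rewrite !addr0 mulr0 subr0 eqxx.
Qed.

(** * Vanishing of the cubic sum *)

Lemma sum_zero_on_lines (f : P -> rat) : zero_on_lines inc f -> \sum_z f z = 0.
Proof.
move=> f0; have [_ [_ ct] _ _] := hS.
have := @sum_two_classes _ _ inc predT pred0 predT t.+1%:R 0 f f0.
rewrite mul0r addr0 => /(_ _ _ _ _)/eqP H; apply/eqP; move: H.
rewrite mulf_eq0 pnatr_eq0; apply=> // z _; congr _%:R; rewrite -(ct z).
by apply: eq_card => l; rewrite !inE andbT.
Qed.

(** Sum over [y] first, for a fixed edge from [x] to [u]: [edge_sum] yields a multiple of [f u].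
    Then the sum of [f x] over the neighbours [x] of [u] is -(t + 1) [f u]. *)
Lemma sum_triples (f : P -> rat) (i : nat) : zero_on_lines inc f -> (i < d)%N ->
  \sum_x \sum_(y | dist x y == i.+1) f x * f y * \sum_(u in steps_toward inc x y) f u
    = - (t%:R + 1) * edge_coef i * \sum_x f x ^+ 3.
Proof.
move=> f0 ltid.
have inner x : \sum_(y | dist x y == i.+1)
      f x * f y * \sum_(u in steps_toward inc x y) f u
    = \sum_(u | adj x u) edge_coef i * f u ^+ 2 * f x.
  under eq_bigr do rewrite mulr_sumr.
  rewrite (exchange_big_dep (adj x)) /= => [|y u _]; last by rewrite inE => /andP[].
  apply: eq_bigr => u axu; rewrite expr2 mulrA -(edge_sum f0 axu ltid) 2!mulr_suml.
  rewrite (eq_bigl (fun z => (dist u z == i) && (dist x z == i.+1))) => [|z].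
    by apply: eq_bigr => z _; ring.
  by rewrite inE axu; case: (eqVneq (dist x z) i.+1) => [->|]; rewrite ?andbF ?andbT.
rewrite (eq_bigr _ (fun x _ => inner x)) (exchange_big_dep xpredT) //= mulr_sumr.
apply: eq_bigr => u _; rewrite -mulr_sumr.
have d1 : (0 < d)%N by apply: leq_ltn_trans ltid.
have := sphere_sum u f0 d1; rewrite (eq_bigl (adj^~ u)) => [->|x].
  have := sphere_edge_coef d1; rewrite tau1 mulr1 => ->.
  by rewrite /edge_coef big_ord0; ring.
rewrite collinear_sym; apply/eqP/idP => [/(adj_pdist1 np)//|/(pdist_adj1 np)//].
Qed.

(* Multiplying the relation for [x, y] by [f x * f y] and summing over all pairs
   at distance [i]: the cubic sums on both sides are multiples of [\sum_x f x ^+ 3],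
   in the ratio [tau i : kappa]. *)
Lemma sum_cubes_eq0 (f : P -> rat) (i : nat) (kappa : rat) :
    zero_on_lines inc f -> (0 < i <= d)%N -> kappa != tau i ->
    (forall x y, dist x y = i ->
      \sum_(u in steps_toward inc x y) f u + \sum_(v in steps_toward inc y x) f v
        = kappa * (f x + f y)) ->
  \sum_x f x ^+ 3 = 0.
Proof.
case: i => // i f0 ltid nkt rel; set W := \sum_x _.
pose T x y := f x * f y * \sum_(u in steps_toward inc x y) f u.
pose pairs (F : P -> P -> rat) := \sum_x \sum_(y | dist x y == i.+1) F x y.
have pairsC F : pairs F = pairs (fun x y => F y x).
  rewrite /pairs (exchange_big_dep xpredT) //=; apply: eq_bigr => y _.
  by apply: eq_bigl => x; rewrite (pdistC np).
have T1 : pairs T = - (t%:R + 1) * edge_coef i * W by apply: sum_triples.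
have Q1 : pairs (fun x y => f x ^+ 2 * f y) = sphere_coef i.+1 * W.
  rewrite mulr_sumr; apply: eq_bigr => x _.
  by rewrite -mulr_sumr sphere_sum //; ring.
have eqTQ : pairs T + pairs (fun x y => T y x) = kappa *
    (pairs (fun x y => f x ^+ 2 * f y) + pairs (fun x y => f y ^+ 2 * f x)).
  rewrite /pairs -!big_split mulr_sumr; apply: eq_bigr => x _.
  rewrite -!big_split mulr_sumr; apply: eq_bigr => y /eqP dxy.
  by rewrite /T (mulrC (f y) (f x)) /= -mulrDr rel //; ring.
move: eqTQ; rewrite -(pairsC T) -(pairsC (fun x y => f x ^+ 2 * f y)) T1 Q1.
rewrite -(sphere_edge_coef ltid) => e.
have phi0 : sphere_coef i.+1 != 0.
  apply: contraNneq (edge_coef_neq0 ltid) => p0.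
  have /esym/eqP := sphere_edge_coef ltid; rewrite p0 mul0r mulf_eq0 oppr_eq0.
  by rewrite natr1 pnatr_eq0.
(* By the symmetry of pairs, each side of [e] is twice a multiple of [W]. *)
have : (tau i.+1 - kappa) * (sphere_coef i.+1 * W) = 0 by lra.
by move/eqP; rewrite !mulf_eq0 subr_eq0 eq_sym (negbTE nkt) (negbTE phi0) => /eqP.
Qed.

End RegularNearPolygon.

(** * Solving the two equations on kappa *)

(* With [a = s ^ n] and [e = (-1) ^ n], the hypothesis on [T] turns the solution
   [T * (q + q ^ n.+1) / (1 + q ^ n.+2)] of the first equation into
   [- s * (S + e * a)], which is negative. *)
Lemma extremal_kappa (s n : nat) (T S : rat) : (0 < s)%N -> 0 < T ->
    T = (s%:R ^+ n.+2 + (-1) ^+ n.+2) * (S + (-1) ^+ n.+2 * s%:R ^+ n)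
          / (s%:R ^+ n + (-1) ^+ n.+2) ->
  let q : rat := - s%:R^-1 in
  exists2 k, k != T &
    k * (1 + q ^+ n.+2) = T * (q + q ^+ n.+1) /\
    k * (q + q ^+ n.+1)
      = 1 + (T - 1) * q ^+ 2 + S * q ^+ n + (T - S) * q ^+ n.+2.
Proof.
move=> s0 T0 hT q; set a : rat := s%:R ^+ n; pose e : rat := (-1) ^+ n.
have eE : (-1) ^+ n.+2 = e by rewrite !exprS /e; ring.
have s1 : 1 <= s%:R :> rat by rewrite ler1n.
have a1 : 1 <= a by rewrite /a exprn_ege1.
have sn0 : s%:R != 0 :> rat by rewrite pnatr_eq0 -lt0n.
have an0 : a != 0 by apply/eqP => a0; lra.
have qn : q ^+ n = e / a by rewrite /q -mulN1r exprMn exprVn.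
have qn1 : q ^+ n.+1 = - e / (a * s%:R).
  by rewrite exprS qn /q; field; rewrite an0 sn0.
have qn2 : q ^+ n.+2 = e / (a * s%:R ^+ 2).
  by rewrite exprS qn1 /q; field; rewrite an0 sn0.
have sn2 : s%:R ^+ n.+2 = a * s%:R ^+ 2 by rewrite !exprS /a; ring.
have e1 : e = 1 \/ e = -1.
  by rewrite /e -signr_odd; case: (odd n); [right | left]; rewrite ?expr1 ?expr0.
move: hT; rewrite eE sn2 -/a => hT.
(* A zero denominator would give [T] the default value 0, against [0 < T]; this excludes [s = 1]
   with [n] odd. *)
have ae0 : a + e != 0 by apply: contraTneq T0 => ae; rewrite hT ae invr0 mulr0 ltxx.
have aep : 0 < a + e by rewrite lt0r ae0; case: e1 => ->; lra.
have as2 : a <= a * s%:R ^+ 2 by rewrite ler_peMr ?exprn_ege1 //; lra.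
have se0 : 0 < a * s%:R ^+ 2 + e by lra.
(* In the formula for [T > 0] the other two factors are positive. *)
have Sp : 0 < S + e * a.
  by move: T0; rewrite hT pmulr_lgt0 ?invr_gt0 // pmulr_rgt0.
exists (- s%:R * (S + e * a)).
  have : 0 < s%:R * (S + e * a) by rewrite mulr_gt0 //; lra.
  by move=> h; apply/eqP => h'; lra.
rewrite qn qn1 qn2 hT /q; case: e1 ae0 => -> ae0; split; field; rewrite ?ae0 ?an0 ?sn0 //.
Qed.

(** * Application to m-ovoids *)

Theorem theorem1p2 (P L : finType) (inc : P -> L -> bool)
    (d s t : nat) (ti : nat -> int) (i : nat)
    (hS : regular_near_polygon inc d s t ti)
    (hi : (3 <= i <= d)%N)
    (hti : (ti i)%:~R + 1 =
           (s%:R ^+ i + (-1) ^+ i)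
             * ((ti i.-1)%:~R + 1 + (-1) ^+ i * s%:R ^+ (i - 2)%N)
             / (s%:R ^+ (i - 2)%N + (-1) ^+ i) :> rat)
    (m : nat) (O : {set P}) (hO : nontrivial_m_ovoid inc m O) :
  hemisystem inc s m O.
Proof.
case: hO => mO O0 OT; split=> //.
pose mu : rat := m%:R / s.+1%:R; pose w z : rat := (z \in O)%:R - mu.
have s1 : s.+1%:R != 0 :> rat by rewrite pnatr_eq0.
have w0 : zero_on_lines inc w.
  move=> l; have [_ [/(_ l) cl _] _ _] := hS; have cO := mO l.
  rewrite sumrB sumr_const -natr_sum -big_mkcondr /= sum1_card -(mulr_natr mu).
  rewrite (_ : #|_| = m); last first.
    by rewrite -cO; apply: eq_card => z; rewrite !inE unfold_in andbC.
  rewrite (_ : #|_| = s.+1); last by rewrite -cl; apply: eq_card => z; rewrite inE.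
  by rewrite /mu divfK ?subrr.
have w3 : \sum_z w z ^+ 3 = 0.
  have [i2 lei] := andP hi; case: i i2 hi lei hti => [|[|n]] // _ hi lei hti.
  have Ti := tau_gt0 hS (j := n.+2) lei; rewrite !subSS subn0 /= in hti.
  have [k kT [k1 k2]] := extremal_kappa (order_s_gt0 hS) Ti hti.
  apply: (sum_cubes_eq0 hS w0 _ kT) => // x y dxy.
  by apply: (steps_relation hS w0); rewrite dxy.
(* [w] takes only the values 1 - mu and -mu, the roots of a quadratic. *)
have wz2 z : w z ^+ 3 = (1 - 2 * mu) * w z ^+ 2 + mu * (1 - mu) * w z.
  by rewrite /w; case: (z \in O); rewrite /=; ring.
have : (1 - 2 * mu) * \sum_z w z ^+ 2 = 0.
  have := w3; rewrite (eq_bigr _ (fun z _ => wz2 z)) big_split /= -!mulr_sumr.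
  by rewrite (sum_zero_on_lines hS w0) mulr0 addr0.
move/eqP; rewrite mulf_eq0 => /orP[|].
  rewrite subr_eq0 => /eqP mu2.
  have -> : m%:R = mu * s.+1%:R by rewrite divfK.
  by rewrite natr1 mulrC; congr (_ * _); lra.
(* Otherwise [w] is identically 0, so the indicator of [O] is constant and [O] is trivial. *)
rewrite psumr_eq0 => [/allP wz|z _]; last exact: sqr_ge0.
have Omu z : (z \in O)%:R = mu.
  by have := wz z; rewrite mem_index_enum sqrf_eq0 subr_eq0 => /(_ isT)/eqP.
have [z zO] : exists z, z \in O by apply/set0Pn/eqP.
case: OT; apply/setP => z'; rewrite inE.
by move: (Omu z') (Omu z); rewrite zO => <-; case: (z' \in O).
Qed.
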